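(* Let $X$ be a graph on $n$ vertices. Then for $k=3,\dots,n$, the number $s_e(C_k,X)$ is determined by the edge zeta function $\zeta_X(\vec u)$. In particular, $\mathrm{Ham}(X)$, the number of Hamiltonian cycles of $X$, is determined by $\zeta_X(\vec u)$.
   Context: Graphs: A graph $X=(V,E)$ is a finite nonempty set $V$ of vertices and a finite multiset $E$ of unordered pairs of vertices, called edges. The symmetric digraph $D(X)$ has vertex set $V$ and, for each edge of $X$, two arcs (an arc $e$ and its inverse arc $\overline e$) on the same endpoints; an arc $e=(u,w)$ has origin $o(e)=u$ and terminus $t(e)=w$, and $\overline e=(w,u)$. Prime cycles: A cycle of length $n$ in $X$ is a sequence $c=(e_1,\dots,e_n)$ of arcs of $D(X)$ with $t(e_i)=o(e_{i+1})$ for $1\le i\le n-1$ and $t(e_n)=o(e_1)$. It has backtracking if $\overline{e_{i+1}}=e_i$ for some $1\le i\le n-1$, and has a tail if $e_1=\overline{e_n}$. It is primitive if it is not obtained by going $r\ge 2$ times around some other cycle. Two cycles are equivalent if they differ by a cyclic permutation (reversing direction is not an equivalence). A prime cycle $[c]$ is an equivalence class of primitive cycles with no backtracking and no tail. Edge zeta function: Associate to each arc $e$ of $D(X)$ a variable $u_e$, and put $g(c)=\prod_{e\text{ arc in }c}u_e$ (with multiplicity). The edge zeta function of $X$ is the function of the $u_e\in\mathbb C$ (sufficiently near $0$) given by $\zeta_X(\vec u)=\prod_{[c]}(1-g(c))^{-1}$, the product over all prime cycles; it is the reciprocal of a polynomial in the $2|E|$ variables $u_e$. Meaning of ''determined by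 $\zeta_X(\vec u)$'': it is assumed that the pairing of the variable of each arc with the variable of its inverse arc is given as part of the data. Thus a quantity $Q(X)$ is determined by $\zeta_X(\vec u)$ if, whenever $X$ and $X'$ both satisfy the hypotheses on $X$ (here: both are graphs on $n$ vertices) and there is a bijection $\varphi$ from the arcs of $D(X)$ to the arcs of $D(X')$ with $\varphi(\overline e)=\overline{\varphi(e)}$ under which $\zeta_X$ becomes $\zeta_{X'}$ (identifying $u_e$ with $u_{\varphi(e)}$), one has $Q(X)=Q(X')$. Subgraph counts: For $R\subseteq E$, the edge-induced subgraph $\langle R\rangle$ has edge set $R$ and as vertices all vertices incident to some edge of $R$. $s_e(W,X)$ is the number of edge-induced subgraphs of $X$ isomorphic to $W$. $C_k$ is the cycle graph on $k$ vertices. A Hamiltonian cycle of a graph $X$ on $n$ vertices is an edge-induced subgraph of $X$ isomorphic to $C_n$; $\mathrm{Ham}(X)$ is the number of these. *)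

(* Defs.v *)
From mathcomp Require Import all_boot all_order all_algebra generic_quotient finmap.
From mathcomp Require Import boolp classical_sets reals topology normedtype.
From mathcomp Require Import complex.
From mathcomp.analysis Require Import showcase.summability.
Import Order.TTheory GRing.Theory Num.Theory numFieldNormedType.Exports.

Set Implicit Arguments.
Unset Strict Implicit.
Unset Printing Implicit Defensive.

Local Open Scope ring_scope.
Local Open Scope quotient_scope.

(* Finite multigraphs; loops and parallel edges are allowed. The pair [ends e]
   stands for the unordered pair {(ends e).1, (ends e).2}: the order in which it
   lists the endpoints is disregarded by [mgraph_iso]. [vert] may be empty, so
   that the subgraph induced by the empty set of edges is an [mgraph]. *)
Record mgraph := MGraph {
  vert : finType;
  edge : finType;
  ends : edge -> vert * vert
}.

Definition same_pair (T : Type) (p q : T * T) : Prop :=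
  p = q \/ p = (q.2, q.1).

Definition mgraph_iso (X Y : mgraph) : Prop :=
  exists (f : vert X -> vert Y) (h : edge X -> edge Y),
    [/\ bijective f, bijective h &
        forall e, same_pair (ends (h e)) (f (ends e).1, f (ends e).2)].

Section EdgeInduced.
Variables (X : mgraph) (R : {set edge X}).

Definition covered (v : vert X) : bool :=
  [exists e in R, (v == (ends e).1) || (v == (ends e).2)].

Fact covered1 (e : {e | e \in R}) : covered (ends (val e)).1.
Proof. by apply/existsP; exists (val e); rewrite (valP e) eqxx. Qed.

Fact covered2 (e : {e | e \in R}) : covered (ends (val e)).2.
Proof. by apply/existsP; exists (val e); rewrite (valP e) eqxx orbT. Qed.

Definition edge_induced : mgraph :=
  @MGraph {v | covered v} {e | e \in R}
    (fun e => (Sub (ends (val e)).1 (covered1 e),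
               Sub (ends (val e)).2 (covered2 e))).
End EdgeInduced.

Definition s_e (W X : mgraph) : nat :=
  #|[set R : {set edge X} | `[< mgraph_iso (edge_induced R) W >] ]%SET|.

(* [ordS i] is [i + 1] modulo [k]; [cycle_graph 1] is a loop and
   [cycle_graph 2] a pair of parallel edges. *)
Definition cycle_graph (k : nat) : mgraph :=
  @MGraph 'I_k 'I_k (fun i => (i, ordS i)).

Definition Ham (X : mgraph) : nat := s_e (cycle_graph #|vert X|) X.

(* The arcs of the symmetric digraph D(X): the edge [e] yields the two arcs
   [(e, false)] and [(e, true)], which are distinct even when [e] is a loop. *)
Definition darc (X : mgraph) : finType := (edge X * bool)%type.

Section PrimeCycles.
Variable X : mgraph.
Implicit Types a b : darc X.

Definition org a : vert X := if a.2 then (ends a.1).2 else (ends a.1).1.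
Definition tgt a : vert X := if a.2 then (ends a.1).1 else (ends a.1).2.
Definition arc_inv a : darc X := (a.1, ~~ a.2).

Definition is_cycle (c : seq (darc X)) : bool :=
  (c != [::]) && path.cycle (fun a b => tgt a == org b) c.

Definition has_backtracking (c : seq (darc X)) : bool :=
  ~~ sorted (fun a b => arc_inv b != a) c.

Definition has_tail (c : seq (darc X)) : bool :=
  if c is a :: c' then a == arc_inv (last a c') else false.

Definition primitive_cycle (c : seq (darc X)) : Prop :=
  ~ exists d r, [/\ is_cycle d, (2 <= r)%N & c = flatten (nseq r d)].

Definition prime_rep (c : seq (darc X)) : bool :=
  [&& is_cycle c, ~~ has_backtracking c, ~~ has_tail c & `[< primitive_cycle c >]].

Definition rot_equiv (c d : {c | prime_rep c}) : bool :=
  `[< exists i, val d = rot i (val c) >].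

Fact rot_equiv_refl : reflexive rot_equiv.
Proof. by move=> c; apply/asboolP; exists 0%N; rewrite rot0. Qed.

Fact rot_equiv_sym : symmetric rot_equiv.
Proof.
have sub c d : rot_equiv c d -> rot_equiv d c.
  move=> /asboolP[i di]; apply/asboolP; exists (size (val d) - i)%N; rewrite di.
  by rewrite -/(rotr i _) rotK.
by move=> c d; apply/idP/idP; apply: sub.
Qed.

Fact rot_equiv_trans : transitive rot_equiv.
Proof.
move=> d c e /asboolP[i di] /asboolP[j ej]; apply/asboolP; rewrite ej di.
have tot k (s : seq (darc X)) : exists2 l, (l <= size s)%N & rot k s = rot l s.
  case: (leqP k (size s)) => [lk|/ltnW lk]; first by exists k.
  by exists 0%N; rewrite // rot0 rot_oversize.
have [k lk ->] := tot i (val c).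
have [l ll ->] := tot j (rot k (val c)).
rewrite size_rot in ll.
by rewrite rot_add_mod //; eexists.
Qed.

Canonical rot_equiv_equiv :=
  EquivRel rot_equiv rot_equiv_refl rot_equiv_sym rot_equiv_trans.

Definition prime_cycle := {eq_quot rot_equiv}.

End PrimeCycles.

(* The field of complex numbers, bundled so that its norm topology is found. *)
Definition Cplx (R : realType) : numClosedFieldType := R[i].

Section Zeta.
Variables (R : realType) (X : mgraph).

Definition cycle_weight (u : darc X -> Cplx R) (c : seq (darc X)) : Cplx R :=
  \prod_(a <- c) u a.

(* Unordered infinite product: the limit, along the directed set of the finite
   sets of prime cycles, of the finite partial products. The weight does not
   depend on the representative [repr c], since all representatives of a prime
   cycle are rotations of one another. *)
Definition edge_zeta (u : darc X -> Cplx R) : Cplx R :=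
  lim ((fun A : {fset prime_cycle X} =>
          \prod_(c <- enum_fset A) (1 - cycle_weight u (val (repr c)))^-1)
       @ totally)%classic.

End Zeta.

(* The variables are matched along [phi]; equality of the two zeta functions is
   equality of germs at 0. *)
Definition same_zeta (R : realType) (X Y : mgraph) (phi : darc X -> darc Y) : Prop :=
  exists2 r : R, 0 < r &
    forall u : darc Y -> Cplx R, (forall a, `|u a| < r%:C%C) ->
      edge_zeta (fun a => u (phi a)) = edge_zeta u.

Definition determined_by_zeta (R : realType) (n : nat) (T : Type)
    (Q : mgraph -> T) : Prop :=
  forall X Y : mgraph, #|vert X| = n -> #|vert Y| = n ->
  forall phi : darc X -> darc Y, bijective phi ->
    (forall a, phi (arc_inv a) = arc_inv (phi a)) ->
    same_zeta R phi -> Q X = Q Y.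

(* Main.v *)
Require Import Defs.
From mathcomp Require Import all_boot all_order all_algebra reals.
From mathcomp Require Import generic_quotient finmap boolp classical_sets.
From mathcomp Require Import topology normedtype complex lra.
From mathcomp.analysis Require Import showcase.summability.
Import Order.TTheory GRing.Theory Num.Theory numFieldNormedType.Exports.

Set Implicit Arguments.
Unset Strict Implicit.
Unset Printing Implicit Defensive.

(** The subgraphs of [X] isomorphic to C_k are the edge sets of its circuits of
    length k, a circuit being a closed walk with distinct vertices and distinct
    edges; each of them is traversed by two circuits up to rotation, one for
    each direction. So it is enough to show that the zeta function recognizes
    which sets of arcs are the arc sets of circuits.

    Fix a set [A] of arcs that does not contain both an arc and its inverse, and
    evaluate the zeta function at the point whose coordinates are a small t > 0
    on [A] and 0 elsewhere. Only the prime cycles supported in [A] contribute.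
    - If there are none, the value is 1 ([edge_zeta_eq1]).
    - If [A] is the arc set of a circuit c of length k, then inside [A] every arc has only
      one successor, so a closed walk in [A] runs around c some number of times
      ([closed_walk_in_circuit]), and c is the only prime cycle supported in
      [A]. The value is (1 - t^k)^-1, which differs from 1
      ([edge_zeta_circuit]).
    In both cases the partial products are eventually constant, so the infinite
    product raises no question of convergence.

    Suppose that phi matches the zeta functions of [X] and [Y], and let c be a
    circuit of [X]. The value at phi(c) is not 1, so phi(c) supports a prime
    cycle of [Y], and a shortest closed walk there is a circuit d contained in
    phi(c) ([circuit_transfer_sub]). The same argument for the inverse of phi
    gives a circuit of [X] contained in the preimage of d, hence in c. A circuit
    contains no smaller one ([circuit_sub_circuit]), so d is all of phi(c)
    ([circuit_transfer]). Thus phi, acting on edges, injects the k-cycles of [X]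
    into those of [Y]; by symmetry there are equally many.

    The argument is uniform in k >= 1, where C_1 is a loop and C_2 a pair of
    parallel edges; this gives the Hamiltonian cycles for every n >= 1. *)

(** * Circuits and closed walks *)

Lemma uniq_map_inj_in (S T : eqType) (f : S -> T) (s : seq S) :
  uniq (map f s) -> {in s &, injective f}.
Proof.
elim: s => //= x s IHs /andP[fx_s Us] y z; rewrite !inE.
case/predU1P=> [->|sy] /predU1P[->|sz] // Eyz; last exact: IHs.
- by rewrite Eyz map_f in fx_s.
- by rewrite -Eyz map_f in fx_s.
Qed.

Section Circuits.
Variable X : mgraph.
Implicit Types (a b : darc X) (c d : seq (darc X)).

(** Distinct edges follow from distinct origins, except in length 2, where this
    condition excludes going along an edge and back. *)
Definition circuit c : bool :=
  [&& is_cycle c, uniq (map (@org X) c) & uniq (map fst c)].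

Lemma is_cycle_rot i c : is_cycle (rot i c) = is_cycle c.
Proof. by rewrite /is_cycle rot_cycle -!size_eq0 size_rot. Qed.

Lemma circuit_uniq c : circuit c -> uniq c.
Proof. by case/and3P=> _ /map_uniq. Qed.

Lemma circuit_arc_inv c a : circuit c -> a \in c -> arc_inv a \notin c.
Proof.
case/and3P=> _ _ /uniq_map_inj_in Uc ca; apply/negP => cia.
by have := Uc a (arc_inv a) ca cia erefl; case: a {ca cia} => e [].
Qed.

(** Backtracking and tails would put an arc and its inverse in [c], and a proper
    power would repeat an arc. *)
Lemma circuit_prime_rep c : circuit c -> prime_rep c.
Proof.
move=> Cc; have cinv := circuit_arc_inv Cc; apply/and4P; split.
- by case/and3P: Cc.
- rewrite negbK; case: c {Cc} cinv => // x p cinv /=; apply/(pathP x) => i lti.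
  apply: contraTneq (mem_nth x (s := x :: p) (n := i.+1) lti) => /= Einv.
  rewrite -[nth x p i]/(nth x (x :: p) i.+1) in Einv *.
  apply/negP => ci1; have := cinv _ ci1; rewrite Einv /=.
  by rewrite mem_nth // ltnS ltnW.
- case: c {Cc} cinv => // x p cinv /=; apply/eqP => Ex.
  by have := cinv _ (mem_last x p); rewrite -Ex mem_head.
- apply/asboolP => -[d [r [/andP[d0 _] r2 Ec]]].
  have := circuit_uniq Cc; rewrite Ec; case: r r2 {Ec} => [|[|r]] // _.
  by case: d d0 => // x p _ /=; rewrite mem_cat mem_head orbT.
Qed.

(** The origins along [c] are distinct, so the only arc of [c] that can follow an
    arc a of [c] is [next c a]. Hence [d] is a cycle of the function [next c],
    whose orbits are the rotations of [c]. *)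
Lemma closed_walk_in_circuit c d : circuit c -> is_cycle d -> {subset d <= c} ->
  exists i r, d = flatten (nseq r.+1 (rot i c)).
Proof.
move=> Cc; have Uc := circuit_uniq Cc; case: d => [|x p] // /andP[_ Wd] dc.
have Uorg : {in c &, injective (@org X)}.
  by apply/uniq_map_inj_in; case/and3P: Cc.
have Nc := cycle_next Uc.
have Nd : fcycle (next c) (x :: p).
  apply: (sub_in_cycle (P := mem c)) Wd; last by apply/allP => a /dc.
  move=> a b ca cb /eqP Eab; apply/eqP/Uorg; rewrite ?mem_next //.
  case/and3P: Cc => /andP[_ /next_cycle Wc] _ _.
  by rewrite -Eab; apply/esym/eqP/Wc.
have [r ->] := fcycle_consEflatten Nd.
by exists (index x c), r; rewrite (orbitE Nc) // dc ?mem_head.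
Qed.

Lemma prime_rep_in_circuit c d : circuit c -> prime_rep d -> {subset d <= c} ->
  exists i, d = rot i c.
Proof.
move=> Cc /and4P[Wd _ _ /asboolP Pd] dc.
have [i [[|r] Ed]] := closed_walk_in_circuit Cc Wd dc.
  by exists i; rewrite Ed /= cats0.
case: Pd; exists (rot i c), r.+2; split=> //.
by rewrite is_cycle_rot; case/and3P: Cc.
Qed.

(** A walk that meets a vertex twice contains the shorter closed walk between the
    two visits, so a shortest closed walk within the arcs of [d] has distinct
    origins. The hypothesis on inverse arcs then makes its edges distinct. *)
Lemma circuit_in_closed_walk d : is_cycle d -> {in d, forall a, arc_inv a \notin d} ->
  exists2 c, circuit c & {subset c <= d}.
Proof.
have [n] := ubnP (size d); elim: n d => // n IHn d /ltnSE le_d Wd Id.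
have [Uo | ] := boolP (uniq (map (@org X) d)).
  exists d => //; rewrite /circuit Wd Uo /=.
  rewrite map_inj_in_uniq ?(map_uniq Uo) // => a b da db Eab.
  have /negP := Id a da; case: a b Eab da db => e s [f t] /= <- _.
  by have [-> // | ] := eqVneq s t; case: s t => [] [].
(* Rotate [d] to start at the first visit x; then x :: p is the loop that ends
   just before the second visit y. *)
case: d Wd le_d Id => // a0 d0; set d := a0 :: d0 => Wd le_d Id.
case/(uniqPn (org a0)) => i [j [lt_ij]]; rewrite size_map => lt_jd.
have lt_id := ltn_trans lt_ij lt_jd.
rewrite !(nth_map a0) //; set x := nth a0 d i; set y := nth a0 d j => Exy.
have Ed : rot i d = x :: drop i.+1 d ++ take i d by rewrite /rot (drop_nth a0).
have yd : y \in drop i.+1 d ++ take i d.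
  rewrite mem_cat; apply/orP; left; apply/(nthP a0).
  exists (j - i.+1); last by rewrite nth_drop subnKC.
  by rewrite size_drop ltn_sub2r // (leq_ltn_trans lt_ij).
case/splitPr: yd Ed => p q Ed.
have [|||c Cc cp] := IHn (x :: p).
- apply: leq_trans le_d; rewrite -(size_rot i d) Ed /= size_cat /= addnS !ltnS.
  exact: leq_addr.
- move: Wd; rewrite -(is_cycle_rot i) Ed /is_cycle /= rcons_cat cat_path /=.
  by case/and3P=> Wp Wy _; rewrite rcons_path Wp /= Exy.
- have sub : {subset x :: p <= d}.
    move=> a; rewrite -(mem_rot i d) Ed !inE mem_cat => /orP[->|->] //.
    by rewrite orbT.
  move=> a ap; apply: contra (Id a (sub _ ap)); exact: sub.
exists c => // a /cp; rewrite -(mem_rot i d) Ed !inE mem_cat.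
by case/orP=> ->; rewrite ?orbT.
Qed.

Lemma circuit_sub_circuit c d : circuit c -> circuit d -> {subset d <= c} -> d =i c.
Proof.
move=> Cc /and3P[Wd _ _] dc a; apply/idP/idP=> [/dc // | ca].
have [i [r ->]] := closed_walk_in_circuit Cc Wd dc.
by rewrite /= mem_cat mem_rot ca.
Qed.

End Circuits.

(** * The zeta function at points supported on few arcs *)

Section ZetaSupport.
Variables (R : realType) (X : mgraph).
Implicit Types (u : darc X -> Cplx R) (c : seq (darc X)).

Local Open Scope ring_scope.
Local Open Scope fset_scope.
Local Open Scope quotient_scope.

Lemma lim_totally_cst (I : choiceType) (F : {fset I} -> Cplx R) (A0 : {fset I}) l :
  (forall A, A0 `<=` A -> F A = l) -> (lim (F @ totally))%classic = l.
Proof.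
by move=> FE; have FF := @totally_filter I; apply: lim_near_cst; last by exists A0.
Qed.

Lemma cycle_weight_neq0 u c : cycle_weight u c != 0 -> forall a, a \in c -> u a != 0.
Proof. by rewrite /cycle_weight prodf_seq_neq0 => /allP u0 a /u0. Qed.

Lemma edge_zeta_eq1 u :
  (forall c, prime_rep c -> cycle_weight u c = 0) -> edge_zeta u = 1.
Proof.
move=> u0; apply: (@lim_totally_cst _ _ fset0) => A _.
by apply: big1 => c _; rewrite u0 ?(valP (repr c)) // subr0 invr1.
Qed.

(** In a partial product that contains the class of [c], every other factor is 1:
    a prime cycle of nonzero weight is supported in [c], hence a rotation of it. *)
Lemma edge_zeta_circuit u c : circuit c -> (forall a, a \notin c -> u a = 0) ->
  edge_zeta u = (1 - cycle_weight u c)^-1.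
Proof.
move=> Cc u0; pose p := \pi_(prime_cycle X) (exist _ c (circuit_prime_rep Cc)).
have rot_p d : prime_rep d -> cycle_weight u d != 0 -> exists i, d = rot i c.
  move=> Pd /cycle_weight_neq0 ud; apply: prime_rep_in_circuit => // a /ud.
  by apply: contraNT => /u0 ->.
apply: (@lim_totally_cst _ _ [fset p]) => A; rewrite fsub1set => Ap.
rewrite (bigD1_seq p) ?fset_uniq //= big1_seq => [|q /andP[q'p _]].
  rewrite mulr1.
  have /eqquotP/asboolP[i ->] : p = \pi_(prime_cycle X) (repr p) by rewrite reprK.
  by congr (1 - _)^-1; apply: perm_big; rewrite perm_rot.
have [->|/rot_p] := eqVneq (cycle_weight u (val (repr q))) 0.
  by rewrite subr0 invr1.
case=> [|i Eq]; first exact: valP.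
case/negP: q'p; rewrite -[q]reprK eq_sym; apply/eqP/eqquotP/asboolP.
by exists i.
Qed.

End ZetaSupport.

(** * Transfer of circuits along a matching of zeta functions *)

Section Transfer.
Variables (R : realType) (X Y : mgraph) (phi : darc X -> darc Y).
Hypothesis phi_inj : injective phi.
Hypothesis phi_inv : forall a, phi (arc_inv a) = arc_inv (phi a).

Local Open Scope ring_scope.

(** Compare the zeta functions at the point that is constant on the image of [c]
    and 0 elsewhere: on [X] the value differs from 1, so on [Y] some prime cycle
    is supported in that image. As [phi] commutes with inversion, the image
    contains no arc together with its inverse. *)
Lemma circuit_transfer_sub c : same_zeta R phi -> circuit c ->
  exists2 d, circuit d & {subset d <= map phi c}.
Proof.
case=> r r_gt0 zetaE Cc; pose t : Cplx R := (r / 2)%:C%C.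
have t_neq0 : t != 0.
  by rewrite /t eq_complex /= eqxx andbT mulf_neq0 ?invr_eq0 ?pnatr_eq0 // gt_eqF.
pose u b := if b \in map phi c then t else 0.
have u_small b : `|u b| < r%:C%C.
  rewrite /u; case: ifP => _; last by rewrite normr0 ltcR.
  by rewrite /t normc_def /= expr0n addr0 sqrtr_sqr ltcR ger0_norm; lra.
have u_support d : cycle_weight u d != 0 -> {subset d <= map phi c}.
  by move=> /cycle_weight_neq0 ud b /ud; rewrite /u; case: ifP; rewrite ?eqxx.
have [d Pd /u_support dc] : exists2 d, prime_rep d & cycle_weight u d != 0.
  apply: contrapT => noprime; have := zetaE u u_small.
  rewrite (edge_zeta_circuit Cc); last first.
    by move=> a; rewrite /u mem_map // => /negbTE ->.
  rewrite edge_zeta_eq1 => [/eqP|d Pd]; last first.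
    by apply: contrapT => /eqP d0; apply: noprime; exists d.
  rewrite invr_eq1 subr_eq addrC -subr_eq subrr eq_sym; apply/negP.
  by rewrite /cycle_weight prodf_seq_neq0; apply/allP => a ca; rewrite /u map_f.
have [||e Ce ed] := @circuit_in_closed_walk Y d; first by case/and4P: Pd.
  move=> b /dc /mapP[a ca ->]; apply/negP => /dc; rewrite -phi_inv mem_map //.
  exact/negP/circuit_arc_inv.
by exists e => // b /ed /dc.
Qed.

End Transfer.

Lemma same_zeta_inverse (R : realType) (X Y : mgraph) (phi : darc X -> darc Y)
    (psi : darc Y -> darc X) :
  cancel phi psi -> cancel psi phi ->
  (forall a, phi (arc_inv a) = arc_inv (phi a)) -> same_zeta R phi ->
  (forall b, psi (arc_inv b) = arc_inv (psi b)) /\ same_zeta R psi.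
Proof.
move=> phiK psiK phi_inv [r r_gt0 zetaE]; split=> [b|].
  by apply: (can_inj phiK); rewrite phi_inv !psiK.
exists r => // u u_small.
have := zetaE (u \o psi) (fun b => u_small (psi b)) => /= <-.
by congr edge_zeta; apply/funext => a; rewrite phiK.
Qed.

(** The circuit found in the image of [c] is all of it: carried back along [psi],
    it contains a circuit inside [c], which must be [c] itself. *)
Lemma circuit_transfer (R : realType) (X Y : mgraph) (phi : darc X -> darc Y)
    (psi : darc Y -> darc X) :
  cancel phi psi -> cancel psi phi ->
  (forall a, phi (arc_inv a) = arc_inv (phi a)) -> same_zeta R phi ->
  forall c, circuit c -> exists2 d, circuit d & d =i map phi c.
Proof.
move=> phiK psiK phi_inv zetaE c Cc.
have [d Cd dc] := circuit_transfer_sub (can_inj phiK) phi_inv zetaE Cc.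
have [psi_inv zetaE'] := same_zeta_inverse phiK psiK phi_inv zetaE.
have [e Ce ed] := circuit_transfer_sub (can_inj psiK) psi_inv zetaE' Cd.
have ec : {subset e <= c}.
  by move=> a /ed /mapP[b /dc /mapP[a' ca' ->] ->]; rewrite phiK.
exists d => // b; apply/idP/idP => [/dc // | /mapP[a ca ->]].
move: ca; rewrite -(circuit_sub_circuit Cc Ce ec) => /ed /mapP[b' db' ->].
by rewrite psiK.
Qed.

(** * Cycle subgraphs are edge sets of circuits *)

Lemma next_nth_mod (T : eqType) (x0 : T) (p : seq T) (i : nat) :
  uniq p -> i < size p -> next p (nth x0 p i) = nth x0 p (i.+1 %% size p).
Proof.
move=> Up lt_ip; rewrite next_nth mem_nth // index_uniq //.
case: p Up lt_ip => // y q Up lt_iq /=.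
have [lt_i1q | ] := ltnP i.+1 (size q).+1.
  by rewrite modn_small //=; apply: set_nth_default.
rewrite ltnS => le_qi; have /eqP -> : i == size q by rewrite eqn_leq le_qi -ltnS lt_iq.
by rewrite modnn nth_default.
Qed.

Lemma fcycle_enum_ord k : fcycle (@ordS k) (enum 'I_k).
Proof.
apply: (cycle_from_next (enum_uniq _)) => i _; apply/eqP/val_inj => /=.
have lt_ik : i < size (enum 'I_k) by rewrite size_enum_ord.
rewrite -[in RHS](nth_ord_enum i i) next_nth_mod ?enum_uniq //.
by rewrite size_enum_ord nth_enum_ord // ltn_mod (leq_trans _ (ltn_ord i)).
Qed.

Lemma inj_surj_bij (S T : Type) (f : S -> T) :
  injective f -> (forall y, exists x, f x = y) -> bijective f.
Proof.
by move=> f_inj /choice[g fK]; exists g; first exact: inj_can_sym fK f_inj.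
Qed.

Lemma mgraph_iso_sym X Y : mgraph_iso X Y -> mgraph_iso Y X.
Proof.
case=> f [h [[f' fK f'K] [h' hK h'K] ends_h]]; exists f', h'; split.
- by exists f.
- by exists h.
move=> e; have := ends_h (h' e); rewrite h'K.
by case=> -> /=; rewrite !fK; [left | right]; case: (ends _).
Qed.

Section CycleSubgraphs.
Variable X : mgraph.
Implicit Types (a : darc X) (c : seq (darc X)) (R : {set edge X}).

Lemma tgt_org_next c : is_cycle c -> {in c, forall a, tgt a = org (next c a)}.
Proof. by case/andP=> _ Wc a ca; apply/eqP/(next_cycle Wc). Qed.

Lemma covered_cycle R c : is_cycle c -> R =i map fst c ->
  forall v, covered R v = (v \in map (@org X) c).
Proof.
move=> Wc Rc v; have orgnext := tgt_org_next Wc; apply/idP/mapP.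
  case/existsP=> e; rewrite Rc => /andP[/mapP[a ca ->]].
  have cna : next c a \in c by rewrite mem_next.
  move: (orgnext a ca); rewrite /org /tgt; case: a ca cna => e' [] /= ca cna Ea.
    case/orP=> /eqP ->; last by exists (e', true).
    by rewrite Ea; exists (next c (e', true)).
  case/orP=> /eqP ->; first by exists (e', false).
  by rewrite Ea; exists (next c (e', false)).
case=> a ca ->; apply/existsP; exists a.1; rewrite Rc map_f //= /org.
by case: a.2; rewrite eqxx ?orbT.
Qed.

(** An isomorphism with the cycle graph lists the vertices v_i and the edges e_i of
    the subgraph, and e_i joins v_i to v_(i+1); orienting each e_i out of v_i
    gives the circuit. *)
Lemma iso_cycle_circuit R k : 0 < k ->
  mgraph_iso (edge_induced R) (cycle_graph k) ->
  exists c, [/\ circuit c, size c = k & R =i map fst c].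
Proof.
move=> k_gt0 [f [h [[f' fK f'K] [h' hK h'K] ends_h]]].
pose v i := sval (f' i); pose e i := sval (h' i).
(* When e_i is a loop the test is false and picks one of its two arcs. *)
pose arc i : darc X := (e i, (ends (e i)).1 != v i).
have [org_arc tgt_arc] : (forall i, org (arc i) = v i)
    /\ (forall i, tgt (arc i) = v (ordS i)).
  have ends_arc i : same_pair (v i, v (ordS i)) (ends (e i)).
    have := ends_h (h' i); rewrite h'K.
    case=> -[/(canLR fK)/(congr1 val)/= Ei /(canLR fK)/(congr1 val)/= ES];
      [left | right]; by rewrite /v Ei ES /=; case: (ends _).
  split=> i; case: (ends_arc i); rewrite /org /tgt /arc /=;
    case: (ends (e i)) => x y /= [-> ES]; by rewrite ?ES ?eqxx //; case: eqVneq.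
exists (map arc (enum 'I_k)); split.
- apply/and3P; split.
  + rewrite /is_cycle -size_eq0 size_map size_enum_ord -lt0n k_gt0 cycle_map.
    apply: sub_cycle (fcycle_enum_ord k) => i _ /eqP <- /=.
    by rewrite org_arc tgt_arc.
  + rewrite -map_comp map_inj_uniq ?enum_uniq // => i j /=; rewrite !org_arc.
    by move/val_inj; apply: can_inj f'K _ _.
  + rewrite -map_comp map_inj_uniq ?enum_uniq //.
    by apply: inj_comp val_inj _; apply: can_inj h'K.
- by rewrite size_map size_enum_ord.
move=> x; rewrite -map_comp; apply/idP/mapP=> [Rx | [i _ ->]]; last exact: valP.
by exists (h (exist _ x Rx)); rewrite ?mem_enum //= /e hK.
Qed.

Lemma circuit_iso_cycle R c : circuit c -> R =i map fst c ->
  mgraph_iso (edge_induced R) (cycle_graph (size c)).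
Proof.
move=> Cc Rc; have /and3P[Wc Uo Ue] := Cc; have Uc := circuit_uniq Cc.
apply: mgraph_iso_sym; pose a i := tnth (in_tuple c) i.
have ca i : a i \in c by apply: mem_tnth.
have a_inj : injective a.
  by move=> i j /eqP; rewrite /a !(tnth_nth (a i)) nth_uniq // => /eqP/val_inj.
have a_surj b : b \in c -> exists i, a i = b.
  by case/(tnthP (in_tuple c)) => i ->; exists i.
have a_next i : next c (a i) = a (ordS i).
  by rewrite /a !(tnth_nth (a i)) next_nth_mod.
have cov i : covered R (org (a i)) by rewrite (covered_cycle Wc) ?map_f.
have Ra i : (a i).1 \in R by rewrite Rc map_f.
exists (fun i => exist (fun v => covered R v) _ (cov i)),
  (fun i => exist (fun e => e \in R) _ (Ra i)); split.
- apply: inj_surj_bij => [i j [] | [v cv]].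
    by move/(uniq_map_inj_in Uo (ca i) (ca j))/a_inj.
  have := cv; rewrite (covered_cycle Wc) // => /mapP[b /a_surj[i <-] Ev].
  by exists i; apply: val_inj.
- apply: inj_surj_bij => [i j [] | [e Re]].
    by move/(uniq_map_inj_in Ue (ca i) (ca j))/a_inj.
  have := Re; rewrite Rc => /mapP[b /a_surj[i <-] Ev].
  by exists i; apply: val_inj.
move=> i; have := tgt_org_next Wc (ca i); rewrite a_next /same_pair /= => Et.
have Eo : (if (a i).2 then _ else _) = org (a i) := erefl.
by move: Et Eo; rewrite /tgt; case: (a i).2 => E1 E2; [right | left];
  congr pair; apply: val_inj.
Qed.

End CycleSubgraphs.

(** * Counting *)

Section EdgeMap.
Variables (X Y : mgraph) (phi : darc X -> darc Y).
Hypothesis phi_inj : injective phi.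
Hypothesis phi_inv : forall a, phi (arc_inv a) = arc_inv (phi a).

Definition edge_map (e : edge X) : edge Y := (phi (e, false)).1.

(** The choice of the arc [(e, false)] does not matter, since [phi] commutes with
    inversion. *)
Lemma edge_mapE a : edge_map a.1 = (phi a).1.
Proof.
case: a => e [] //=; rewrite /edge_map.
by have -> : (e, true) = arc_inv (e, false) by []; rewrite phi_inv.
Qed.

Lemma edge_map_inj : injective edge_map.
Proof.
move=> e e'; rewrite /edge_map => Ee.
have : phi (e, false) = phi (e', false) \/ phi (e, false) = phi (arc_inv (e', false)).
  rewrite phi_inv; case: (phi _) (phi _) Ee => x s [y t] /= ->.
  by rewrite /arc_inv /=; case: s t => [] []; [left | right | right | left].
by case=> /phi_inj [].
Qed.

End EdgeMap.

Lemma s_e_cycle_leq (R : realType) (k : nat) (X Y : mgraph)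
    (phi : darc X -> darc Y) (psi : darc Y -> darc X) :
  0 < k -> cancel phi psi -> cancel psi phi ->
  (forall a, phi (arc_inv a) = arc_inv (phi a)) -> same_zeta R phi ->
  s_e (cycle_graph k) X <= s_e (cycle_graph k) Y.
Proof.
move=> k_gt0 phiK psiK phi_inv zetaE; have phi_inj := can_inj phiK.
rewrite /s_e -(card_imset _ (imset_inj (edge_map_inj phi_inj phi_inv))).
apply/subset_leq_card/fintype.subsetP => _ /imsetP[A + ->].
rewrite !finset.in_set => /asboolP isoA; apply/asboolP.
have [c [Cc szc Ac]] := iso_cycle_circuit k_gt0 isoA.
have [d Cd dc] := circuit_transfer phiK psiK phi_inv zetaE Cc.
have <- : size d = k.
  rewrite -szc -(size_map phi); apply/eqP; rewrite -uniq_size_uniq //.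
  + exact: circuit_uniq.
  + by rewrite map_inj_uniq // circuit_uniq.
apply: circuit_iso_cycle => // e; apply/imsetP/mapP => [[f] | [b]].
  rewrite Ac => /mapP[a ca ->] ->; exists (phi a); last exact: edge_mapE.
  by rewrite dc map_f.
rewrite dc => /mapP[a ca ->] ->; exists a.1; last by rewrite edge_mapE.
by rewrite Ac map_f.
Qed.

Lemma s_e_cycle_determined (R : realType) (n k : nat) : 0 < k ->
  determined_by_zeta R n (fun X => s_e (cycle_graph k) X).
Proof.
move=> k_gt0 X Y _ _ phi [psi phiK psiK] phi_inv zetaE; apply/eqP.
rewrite eqn_leq (s_e_cycle_leq k_gt0 phiK psiK phi_inv zetaE) /=.
have [psi_inv zetaE'] := same_zeta_inverse phiK psiK phi_inv zetaE.
exact: (s_e_cycle_leq k_gt0 psiK phiK psi_inv zetaE').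
Qed.

Theorem corollary1 (R : realType) (n : nat) (n_gt0 : 0 < n) :
  (forall k : nat, 3 <= k <= n ->
     determined_by_zeta R n (fun X : mgraph => s_e (cycle_graph k) X)) /\
  determined_by_zeta R n Ham.
Proof.
split=> [k /andP[k_ge3 _] | X Y nX nY]; last first.
  by rewrite /Ham nX nY; apply: s_e_cycle_determined n_gt0 X Y nX nY.
by apply: s_e_cycle_determined; apply: leq_trans k_ge3.
Qed.
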